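(* Let $Q(\cdot)$ be a finite quasigroup and let $i\in Q$ be such that the part $\Phi_i$ of the halo $\Phi_Q$ of $Q(\cdot)$ is special. Then $\gamma(i)=i$ for every autotopism $(\alpha,\beta,\gamma)$ of $Q(\cdot)$.
   Context: $Q=\{1,2,\ldots,n\}$ is a finite set and $Q(\cdot)$ is a quasigroup on $Q$ (for all $a,b\in Q$ the equations $a\cdot x=b$ and $y\cdot a=b$ have unique solutions). Permutations are composed by $\varphi\psi(x)=\varphi(\psi(x))$. For $i\in Q$, the track $\varphi_i$ of $Q(\cdot)$ is the permutation of $Q$ determined by $x\cdot\varphi_i(x)=i$ for all $x\in Q$. The spins of $Q(\cdot)$ are the permutations $\varphi_{ij}=\varphi_i\varphi_j^{-1}$, $i,j\in Q$; the spins $\varphi_{ii}$ are called trivial. The collection $\Phi_Q$ of all non-trivial spins (indexed by pairs $(i,j)$ with $i\neq j$) is called the halo, and it is divided into the parts $\Phi_i=\{\varphi_{ij} : j\in Q,\ j\neq i\}$ (families indexed by $j$), $i\in Q$. For a permutation $\sigma$ of $Q$, $Z(\sigma)$ denotes its cycle type, i.e. the multiset of lengths of all its cycles (fixed points included). The spectrum of a family $\Phi=\{\sigma_1,\ldots,\sigma_k\}$ of permutations is the multiset $Sp(\Phi)=[Z(\sigma_1),\ldots,Z(\sigma_k)]$. The part $\Phi_i$ is called special if $Sp(\Phi_i)\neq Sp(\Phi_k)$ for all $k\in Q$, $k\neq i$. An autotopism of $Q(\cdot)$ is a triple $(\alpha,\beta,\gamma)$ of permutations of $Q$ such that $\gamma(x\cdot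 y)=\alpha(x)\cdot\beta(y)$ for all $x,y\in Q$. *)

(* Defs.v *)
From mathcomp Require Import all_boot all_fingroup.
From mathcomp Require Import finmap multiset.

Set Implicit Arguments.
Unset Strict Implicit.
Unset Printing Implicit Defensive.

(* The carrier {1, ..., n} is rendered as 'I_n = {0, ..., n-1}. *)
Record quasigroup (n : nat) := Quasigroup {
  qop :> 'I_n -> 'I_n -> 'I_n;
  qop_ldiv : forall a b : 'I_n, exists! x : 'I_n, qop a x = b;
  qop_rdiv : forall a b : 'I_n, exists! y : 'I_n, qop y a = b
}.

Section Halo.

Variables (n : nat) (Q : quasigroup n).

Lemma ldiv_ex (i x : 'I_n) : exists y : 'I_n, Q x y == i.
Proof. by have [y [/eqP Hy _]] := qop_ldiv Q x i; exists y. Qed.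

Definition track_fun (i x : 'I_n) : 'I_n := xchoose (ldiv_ex i x).

Lemma track_funP (i x : 'I_n) : Q x (track_fun i x) = i.
Proof. exact/eqP/(xchooseP (ldiv_ex i x)). Qed.

Lemma track_fun_inj (i : 'I_n) : injective (track_fun i).
Proof.
move=> x y Exy; have [z [_ Uz]] := qop_rdiv Q (track_fun i x) i.
rewrite -(Uz x (track_funP i x)); apply: Uz.
by rewrite Exy track_funP.
Qed.

Definition track (i : 'I_n) : {perm 'I_n} := perm (@track_fun_inj i).

Lemma trackP (i x : 'I_n) : Q x (track i x) = i.
Proof. by rewrite permE track_funP. Qed.

Lemma track_unique (i : 'I_n) (s : {perm 'I_n}) :
  (forall x, Q x (s x) = i) -> s = track i.
Proof.
move=> Hs; apply/permP => x; have [z [_ Uz]] := qop_ldiv Q x i.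
by rewrite -(Uz _ (Hs x)) -(Uz _ (trackP i x)).
Qed.

(* MathComp composes permutations left to right, (s * t) x = t (s x), so the
   spin x |-> track i ((track j)^-1 x) is the product below; see spinE. *)
Definition spin (i j : 'I_n) : {perm 'I_n} := ((track j)^-1 * track i)%g.

Lemma spinE (i j x : 'I_n) : spin i j x = track i ((track j)^-1%g x).
Proof. by rewrite permM. Qed.

(* A list, not a set: equal spins with distinct indices j count separately. *)
Definition part (i : 'I_n) : seq {perm 'I_n} :=
  [seq spin i j | j in [pred j : 'I_n | j != i]].

End Halo.

(* porbits s is the set of all cycles of s, including the fixed points. *)
Definition cycle_type (T : finType) (s : {perm T}) : {mset nat}%mset :=
  seq_mset [seq #|C| | C : {set T} in porbits s].

Definition spectrum (T : finType) (Phi : seq {perm T}) : {mset {mset nat}}%mset :=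
  seq_mset [seq cycle_type s | s <- Phi].

Definition special (n : nat) (Q : quasigroup n) (i : 'I_n) : Prop :=
  forall k : 'I_n, k != i -> spectrum (part Q i) <> spectrum (part Q k).

Definition autotopism (n : nat) (Q : quasigroup n)
    (alpha beta gamma : {perm 'I_n}) : Prop :=
  forall x y : 'I_n, gamma (Q x y) = Q (alpha x) (beta y).

(* Main.v *)
(** An autotopism carries the track of [i] to that of [gamma i], so it
    conjugates the spin of [(i, j)] by [beta] into that of
    [(gamma i, gamma j)].  Conjugation preserves cycle types, so the parts of
    [i] and [gamma i] have the same spectrum. *)
Require Import Defs.
From mathcomp Require Import all_boot all_fingroup.
From mathcomp Require Import finmap multiset.

(** Powers commute with conjugation, so [(s ^ b) ^+ k] sends [b x] to [b ((s ^+ k) x)]. *)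
Lemma porbitJ (T : finType) (s b : {perm T}) (x : T) :
  porbit (s ^ b)%g (b x) = b @: porbit s x.
Proof.
apply/setP => y; apply/porbitP/imsetP => [[k ->]|[_ /porbitP[k ->] ->]].
  by exists ((s ^+ k)%g x); rewrite ?mem_porbit // -conjXg permJ.
by exists k; rewrite -conjXg permJ.
Qed.

Lemma porbitsJ (T : finType) (s b : {perm T}) :
  porbits (s ^ b)%g = [set b @: C | C : {set T} in porbits s].
Proof.
apply/setP => C; apply/imsetP/imsetP => [[y _ ->]|[_ /imsetP[x _ ->] ->]].
  by exists (porbit s (b^-1%g y)); rewrite ?imset_f // -porbitJ permKV.
by exists (b x); rewrite ?porbitJ.
Qed.

(** The map [C |-> b @: C] is a size-preserving bijection from the cycles of [s] to those of
    [s ^ b]. *)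
Lemma cycle_typeJ (T : finType) (s b : {perm T}) :
  cycle_type (s ^ b)%g = cycle_type s.
Proof.
have imb_inj : injective (fun C : {set T} => b @: C).
  exact: imset_inj perm_inj.
apply/eq_seq_msetP; rewrite /image_mem porbitsJ.
(* The two enumerations may list the cycles in different orders; both are duplicate-free because
   [imb_inj] holds. *)
have /(perm_map (fun C : {set T} => #|C|)) /perm_trans -> // :
    perm_eq (enum [set b @: C | C : {set T} in porbits s])
            [seq b @: C | C : {set T} <- enum (porbits s)].
  apply: uniq_perm; rewrite ?map_inj_uniq ?enum_uniq // => C.
  rewrite mem_enum; apply/imsetP/mapP => -[D sD ->]; exists D => //.
    by rewrite mem_enum.
  by rewrite mem_enum in sD.
rewrite -map_comp; apply/seq.permP => a; congr (count a _).
by apply: eq_map => C /=; rewrite card_imset //; apply: perm_inj.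
Qed.

Section Autotopism.

Variables (n : nat) (Q : quasigroup n) (alpha beta gamma : {perm 'I_n}).
Hypothesis Hautotopism : autotopism Q alpha beta gamma.

Lemma track_autotopism (i : 'I_n) :
  track Q (gamma i) = (alpha^-1 * track Q i * beta)%g.
Proof.
(* With [y] the preimage of [x] under [alpha], the product of [x] and [beta (track Q i y)] is
   [gamma (Q y (track Q i y))], that is [gamma i]. *)
apply/esym/track_unique => x.
by rewrite !permM -{1}(permKV alpha x) -Hautotopism trackP.
Qed.

(** The inner factors [alpha] and [alpha^-1] cancel, so only [beta] remains. *)
Lemma spin_autotopism (i j : 'I_n) :
  spin Q (gamma i) (gamma j) = (spin Q i j ^ beta)%g.
Proof.
by rewrite /spin !track_autotopism conjgE !invMg invgK !mulgA mulgK.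
Qed.

(** Reindexing by [gamma] takes the indices [j != i] bijectively to those different from [gamma i],
    though not in list order. *)
Lemma part_autotopism (i : 'I_n) :
  perm_eq (part Q (gamma i)) [seq (s ^ beta)%g | s <- part Q i].
Proof.
rewrite /part /image_mem -map_comp.
rewrite -(eq_map (fun j => spin_autotopism i j)).
rewrite (map_comp (spin Q (gamma i)) gamma); apply: perm_map.
apply: uniq_perm; rewrite ?(map_inj_uniq perm_inj) ?enum_uniq // => j.
rewrite -[j](permKV gamma) (mem_map perm_inj) !mem_enum !inE.
by rewrite (inj_eq perm_inj).
Qed.

Lemma spectrum_autotopism (i : 'I_n) :
  spectrum (part Q (gamma i)) = spectrum (part Q i).
Proof.
apply/eq_seq_msetP/(perm_trans (perm_map _ (part_autotopism i))).
by rewrite -map_comp (eq_map (fun s => cycle_typeJ _ s beta)).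
Qed.

End Autotopism.

Theorem lemma3p3 (n : nat) (Q : quasigroup n) (i : 'I_n)
    (Hspecial : special Q i) (alpha beta gamma : {perm 'I_n})
    (Hautotopism : autotopism Q alpha beta gamma) :
  gamma i = i.
Proof.
apply/eqP/contraT => /Hspecial []; apply/esym.
exact: spectrum_autotopism Hautotopism i.
Qed.
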